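(* Let $(G,B,m,w)$ be a weighted finite graph with boundary such that each connected component of $G$ contains some interior vertices. Then $$\nu_i+\lambda_{\min}(A_BL_B^{-1}A_\Omega)\le\lambda_i\le\nu_i+\lambda_{\max}(A_BL_B^{-1}A_\Omega)$$ for $i=1,2,\dots,|\Omega|$, with equalities for all $i=1,2,\dots,|\Omega|$ if and only if $A_BL_B^{-1}A_\Omega:\mathbb{R}^\Omega\to\mathbb{R}^\Omega$ is a scalar operator (a scalar multiple of the identity).
   Context: A weighted finite graph $(G,m,w)$ is a finite simple graph $G$ with vertex set $V$ and edge set $E$, a vertex-measure $m:V\to(0,\infty)$ and an edge-weight $w:E\to(0,\infty)$; $w$ is extended to a symmetric function on $V\times V$ by $w_{xy}=0$ when $\{x,y\}\notin E$. A weighted finite graph with boundary $(G,B,m,w)$ is a weighted finite graph with a nonempty subset $B\subset V$ (the boundary); $\Omega=V\setminus B$ is the interior. $\mathbb{R}^S$ is the space of real functions on $S$, with inner product $\langle u,v\rangle_S=\sum_{x\in S}u(x)v(x)m_x$. Laplacian: $\Delta u(x)=\frac1{m_x}\sum_{y\in V}(u(x)-u(y))w_{xy}$ for $u\in\mathbb{R}^V$. Dirichlet Laplacian: for $u\in\mathbb{R}^\Omega$ let $E_0(u)\in\mathbb{R}^V$ be its extension by $0$ on $B$, and $\Delta^Du=(\Delta E_0(u))|_\Omega$, a nonnegative self-adjoint operator on $\mathbb{R}^\Omega$ with eigenvalues (Dirichlet eigenvalues), counted with multiplicity, $0\le\lambda_1\le\dots\le\lambda_{|\Omega|}$. Neumann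 Laplacian: for $u\in\mathbb{R}^\Omega$, let $N_0(u)\in\mathbb{R}^V$ be the function with $N_0(u)=u$ on $\Omega$ and $\Delta N_0(u)=0$ on $B$ (unique since each component contains interior vertices). Set $\Delta^N u=(\Delta N_0(u))|_\Omega$, a nonnegative self-adjoint operator on $\mathbb{R}^\Omega$ with eigenvalues (Neumann eigenvalues), counted with multiplicity, $0\le\nu_1\le\dots\le\nu_{|\Omega|}$. Weighted adjacency operators: $A_B:\mathbb{R}^B\to\mathbb{R}^\Omega$, $A_Bu(x)=\frac1{m_x}\sum_{y\in B}u(y)w_{xy}$ for $x\in\Omega$, and $A_\Omega:\mathbb{R}^\Omega\to\mathbb{R}^B$, $A_\Omega u(x)=\frac1{m_x}\sum_{y\in\Omega}u(y)w_{xy}$ for $x\in B$. $L_B:\mathbb{R}^B\to\mathbb{R}^B$ is the Dirichlet Laplacian with Dirichlet boundary value on $\Omega$: $L_Bf=(\Delta\tilde f)|_B$, where $\tilde f$ is the extension of $f$ by $0$ on $\Omega$; it is invertible because each component of $G$ contains interior vertices. $A_BL_B^{-1}A_\Omega$ is self-adjoint on $\mathbb{R}^\Omega$. $\lambda_{\min}(T)$ and $\lambda_{\max}(T)$ are the minimal and maximal eigenvalues of $T$. *)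

(* Defs.v *)
From HB Require Import structures.
From mathcomp Require Import all_boot all_order all_algebra.
From mathcomp Require Import boolp classical_sets reals.
From mathcomp Require polyrcf.

Set Implicit Arguments.
Unset Strict Implicit.
Unset Printing Implicit Defensive.

Import Order.TTheory GRing.Theory Num.Theory.
Local Open Scope ring_scope.

(* [weight] is the edge-weight already extended by 0 to all pairs of vertices. *)
Record wgraph (R : realType) (V : finType) := WGraph {
  edge : rel V;
  edge_sym : symmetric edge;
  edge_irr : irreflexive edge;
  measure : V -> R;
  measure_gt0 : forall x, 0 < measure x;
  weight : V -> V -> R;
  weight_sym : forall x y, weight x y = weight y x;
  weight_gt0 : forall x y, edge x y -> 0 < weight x y;
  weight_eq0 : forall x y, ~~ edge x y -> weight x y = 0 }.

Notation vtx S := {x | x \in S}.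
(* R^o makes the function spaces R-vector spaces. *)
Notation Fun R V := {ffun V -> R^o}.
Notation FunOn R S := {ffun vtx S -> R^o}.

Section Spectrum.
Variables (R : realType) (U : vectType R).

Definition is_eigenvalue_list (T : 'End(U)) (s : seq R) : Prop :=
  sorted <=%R s /\
  forall a : R, count_mem a s = \dim (passmx.leigenspace T a).

(* The multiplicity of an eigenvalue is the dimension of its eigenspace, which
   is also its algebraic multiplicity when T is self-adjoint for some inner
   product; the list then has exactly \dim {:U} entries. *)
Definition eigenvalues (T : 'End(U)) : seq R :=
  xget [::] [set s | is_eigenvalue_list T s]%classic.

Definition lambda_min (T : 'End(U)) : R := head 0 (eigenvalues T).
Definition lambda_max (T : 'End(U)) : R := last 0 (eigenvalues T).

Definition scalar_operator (T : 'End(U)) : Prop :=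
  exists c : R, T = c *: \1%VF.

Lemma is_eigenvalue_list_uniq (T : 'End(U)) s t :
  is_eigenvalue_list T s -> is_eigenvalue_list T t -> s = t.
Proof.
move=> [s1 s2] [t1 t2]; apply: (sorted_eq le_trans le_anti s1 t1).
by apply/allP => a _ /=; rewrite s2 t2.
Qed.

Lemma eigenvaluesP (T : 'End(U)) : is_eigenvalue_list T (eigenvalues T).
Proof.
apply: (@xgetPex _ _ [set s | is_eigenvalue_list T s]%classic).
pose b := vbasis {:U}; have bb : basis_of {:U} b := vbasisP _.
pose p := char_poly (passmx.mxof b b T).
have p0 : p != 0 by rewrite monic_neq0 ?char_poly_monic.
pose r := polyrcf.rootsR p.
have rE a : (a \in r) = root p a.
  by have /(_ a) := polyrcf.roots_on_rootsR p0; rewrite in_itv /= => ->.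
have ru : uniq r by apply: polyrcf.uniq_roots.
pose s := flatten [seq nseq (\dim (passmx.leigenspace T a)) a | a <- r].
exists (sort <=%R s); split; first by apply: sort_sorted; apply: le_total.
move=> a; rewrite count_sort count_flatten -map_comp sumnE big_map.
under eq_bigr do rewrite /= count_nseq /=.
have [ar|ar] := boolP (a \in r).
  rewrite (bigD1_seq a) //= eqxx mul1n big1_seq ?addn0 // => c /andP[ca _].
  by rewrite (negbTE ca) mul0n.
rewrite big1_seq => [|c /= cr]; last first.
  by case: eqP cr ar => [->|] // ->.
apply/esym/eqP; rewrite dimv_eq0 (passmx.leigenspaceE bb).
move: ar; rewrite rE /p -eigenvalue_root_char /eigenvalue negbK => /eqP ->.
by rewrite (passmx.vsof0 bb).
Qed.

End Spectrum.

Section Operators.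
Variables (R : realType) (V : finType) (G : wgraph R V).
Local Notation m := (measure G).
Local Notation w := (weight G).

Definition laplacian (u : Fun R V) : Fun R V :=
  [ffun x => (m x)^-1 * \sum_(y : V) (u x - u y) * w x y].

Definition restrict (S : {set V}) (u : Fun R V) : FunOn R S :=
  [ffun x => u (val x)].

Definition extend0 (S : {set V}) (u : FunOn R S) : Fun R V :=
  [ffun x => oapp u 0 (insub x)].

Definition adjacency (S T : {set V}) (u : FunOn R S) : FunOn R T :=
  [ffun x => (m (val x))^-1 * \sum_(y : vtx S) u y * w (val x) (val y)].

Fact laplacian_is_linear : linear laplacian.
Proof.
move=> a u v; apply/ffunP => x.
rewrite [LHS]ffunE [RHS]ffunE [X in _ = X + _]ffunE !(ffunE _ x).
rewrite -[RHS]/(a * (_ * _) + _ * _ : R) mulrCA -mulrDr [in RHS]mulr_sumr.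
rewrite -big_split /=.
congr (_ * _); apply: eq_bigr => y _; rewrite !ffunE mulrA -mulrDl.
by rewrite mulrBr opprD addrACA.
Qed.
HB.instance Definition _ :=
  GRing.isLinear.Build R (Fun R V) (Fun R V) _ laplacian laplacian_is_linear.

Fact restrict_is_linear (S : {set V}) : linear (restrict S).
Proof. by move=> a u v; apply/ffunP => x; rewrite !ffunE. Qed.
HB.instance Definition _ (S : {set V}) :=
  GRing.isLinear.Build R (Fun R V) (FunOn R S) _ (@restrict S)
    (@restrict_is_linear S).

Fact extend0_is_linear (S : {set V}) : linear (@extend0 S).
Proof.
move=> a u v; apply/ffunP => x; rewrite !ffunE.
by case: insub => [y|] /=; rewrite ?ffunE // scaler0 addr0.
Qed.
HB.instance Definition _ (S : {set V}) :=
  GRing.isLinear.Build R (FunOn R S) (Fun R V) _ (@extend0 S)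
    (@extend0_is_linear S).

Fact adjacency_is_linear (S T : {set V}) : linear (@adjacency S T).
Proof.
move=> a u v; apply/ffunP => x.
rewrite [LHS]ffunE [RHS]ffunE [X in _ = X + _]ffunE !(ffunE _ x).
rewrite -[RHS]/(a * (_ * _) + _ * _ : R) mulrCA -mulrDr [in RHS]mulr_sumr.
rewrite -big_split /=.
by congr (_ * _); apply: eq_bigr => y _; rewrite !ffunE mulrA -mulrDl.
Qed.
HB.instance Definition _ (S T : {set V}) :=
  GRing.isLinear.Build R (FunOn R S) (FunOn R T) _ (@adjacency S T)
    (@adjacency_is_linear S T).

(* The Laplacian on R^S with Dirichlet boundary value 0 on the complement of S. *)
Definition dirichlet_on (S : {set V}) : 'End(FunOn R S) :=
  linfun (@restrict S \o laplacian \o @extend0 S).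

Variable B : {set V}.

Definition dirichlet_laplacian : 'End(FunOn R (~: B)) := dirichlet_on (~: B).

Definition is_neumann_extension (u : FunOn R (~: B)) (v : Fun R V) : Prop :=
  (forall x : vtx (~: B), v (val x) = u x) /\
  (forall x, x \in B -> laplacian v x = 0).

Definition neumann_extension (u : FunOn R (~: B)) : Fun R V :=
  xget 0 [set v | is_neumann_extension u v]%classic.

(* [linfun] is meaningful here by [neumann_extension_linear]. *)
Definition neumann_laplacian : 'End(FunOn R (~: B)) :=
  linfun (@restrict (~: B) \o laplacian \o neumann_extension).

Definition A_B : 'Hom(FunOn R B, FunOn R (~: B)) :=
  linfun (@adjacency B (~: B)).
Definition A_Omega : 'Hom(FunOn R (~: B), FunOn R B) :=
  linfun (@adjacency (~: B) B).
Definition L_B : 'End(FunOn R B) := dirichlet_on B.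

(* [L_B^-1] is the two-sided inverse by [lker_L_B]. *)
Definition A_LB_A : 'End(FunOn R (~: B)) := (A_B \o L_B^-1 \o A_Omega)%VF.

Definition interior_in_components : Prop :=
  forall x : V, exists2 y : V, y \in ~: B & connect (edge G) x y.

Lemma extend0_in (S : {set V}) (u : FunOn R S) (x : vtx S) :
  extend0 u (val x) = u x.
Proof. by rewrite ffunE valK. Qed.

Lemma extend0_out (S : {set V}) (u : FunOn R S) x :
  x \notin S -> extend0 u x = 0.
Proof. by move=> xS; rewrite ffunE insubN. Qed.

Lemma green (v : Fun R V) :
  \sum_x \sum_y w x y * (v x - v y) ^+ 2 =
  (\sum_x m x * v x * laplacian v x) *+ 2.
Proof.
have E : \sum_x m x * v x * laplacian v x =
    \sum_x \sum_y w x y * (v x - v y) * v x.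
  apply: eq_bigr => x _; rewrite ffunE mulrA (mulrAC (m x)).
  rewrite divff ?lt0r_neq0 ?measure_gt0 // mul1r mulr_sumr.
  by apply: eq_bigr => y _; rewrite mulrC (mulrC (w x y)).
rewrite mulr2n E [X in _ + X]exchange_big -big_split /=.
apply: eq_bigr => x _; rewrite -big_split /=; apply: eq_bigr => y _.
by rewrite (weight_sym G y x) -(opprB (v x) (v y)) mulrN mulNr -mulrBr -mulrA.
Qed.

Hypothesis intB : interior_in_components.

Lemma harmonic_eq0 (v : Fun R V) :
  (forall x, x \in ~: B -> v x = 0) ->
  (forall x, x \in B -> laplacian v x = 0) -> v = 0.
Proof.
move=> vO vB.
have w_ge0 x y : 0 <= w x y.
  by have [/weight_gt0/ltW|/weight_eq0->] := boolP (edge G x y).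
have t_ge0 x y : 0 <= w x y * (v x - v y) ^+ 2 by rewrite mulr_ge0 ?sqr_ge0.
have /eqP : \sum_x \sum_y w x y * (v x - v y) ^+ 2 = 0.
  rewrite green big1 ?mul0rn // => x _.
  have [xB|xB] := boolP (x \in B); first by rewrite vB ?mulr0.
  by rewrite vO ?inE // mulr0 mul0r.
rewrite psumr_eq0 => [|x _]; last by apply: sumr_ge0.
move=> /allP h.
have vE x y : edge G x y -> v x = v y.
  move=> exy; have := h x (mem_index_enum _); rewrite psumr_eq0 //= => /allP.
  move=> /(_ y (mem_index_enum _)) /=.
  by rewrite mulf_eq0 gt_eqF ?weight_gt0 //= sqrf_eq0 subr_eq0 => /eqP.
apply/ffunP => x; rewrite [RHS]ffunE.
have [y yO /connectP[p pp yl]] := intB x.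
rewrite -(vO _ yO) {y yO}yl; elim: p x pp => //= y p IH x /andP[/vE-> /IH].
by [].
Qed.

Lemma lker_L_B : lker L_B = 0%VS.
Proof.
apply/eqP; rewrite -subv0; apply/subvP => f; rewrite memv_ker memv0 lfunE /=.
move=> /eqP/ffunP h; apply/eqP/ffunP => x; rewrite ffunE -extend0_in.
rewrite (@harmonic_eq0 (extend0 f)) ?ffunE // => y yB.
  by rewrite extend0_out //; rewrite inE in yB.
have -> : y = val (exist _ y yB : vtx B) by [].
by have := h (exist _ y yB); rewrite [X in X = _]ffunE [X in _ = X]ffunE.
Qed.

Lemma neumann_extensionP u : is_neumann_extension u (neumann_extension u).
Proof.
apply: (@xgetPex _ _ [set v | is_neumann_extension u v]%classic).
pose f := (L_B^-1)%VF (restrict B (laplacian (extend0 u))).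
have fE : L_B f = restrict B (laplacian (extend0 u)).
  by rewrite /f lker0_lfunVK // lker_L_B.
exists (extend0 u - extend0 f); split=> [x|x xB].
  rewrite !ffunE valK /= insubN ?subr0 //.
  by have := valP x; rewrite inE.
move: fE; rewrite lfunE /= => /ffunP /(_ (exist _ x xB)) h.
rewrite linearB; move: h; rewrite [X in X = _]ffunE [X in _ = X]ffunE /= => h.
by rewrite [LHS]ffunE [X in _ + X]ffunE /= h subrr.
Qed.

Lemma neumann_extension_unique u v :
  is_neumann_extension u v -> neumann_extension u = v.
Proof.
move=> [v1 v2]; have [n1 n2] := neumann_extensionP u.
apply/eqP; rewrite -subr_eq0; apply/eqP/harmonic_eq0 => x xB.
  have -> : x = val (exist _ x xB : vtx (~: B)) by [].
  by rewrite ffunE [X in _ + X]ffunE n1 v1 subrr.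
by rewrite linearB [LHS]ffunE [X in _ + X]ffunE n2 // v2 // subrr.
Qed.

Lemma neumann_extension_linear : linear neumann_extension.
Proof.
move=> a u v; have [u1 u2] := neumann_extensionP u.
have [v1 v2] := neumann_extensionP v.
apply: neumann_extension_unique; split=> x => [|xB].
  by rewrite ffunE [X in X + _]ffunE u1 v1 [RHS]ffunE [X in _ = X + _]ffunE.
rewrite linearP [LHS]ffunE [X in X + _]ffunE u2 // v2 // scaler0 addr0 //.
Qed.

End Operators.

(* Main.v *)
(** N_0(u) - E_0(u) vanishes on Omega and equals L_B^-1 A_Omega u on B, so
    Delta^D = Delta^N + T with T = A_B L_B^-1 A_Omega, all three self-adjoint for the
    inner product weighted by m. Weyl's inequalities follow by intersecting the
    spectral subspace of Delta^D above (below) its i-th eigenvalue with that of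
    Delta^N below (above) its i-th eigenvalue, and comparing Rayleigh quotients on a
    common nonzero vector. If all the inequalities on one side are equalities, taking
    traces shows that the eigenvalues of T sum to |Omega| times its extreme eigenvalue,
    so they are all equal to it.

    The real spectral theorem is obtained from the minimal polynomial p: for a
    self-adjoint M, a factor (X - a)^2 + b^2 of p could be replaced by X - a, because
    |w(M - a)|^2 + b^2 |w|^2 = 0 forces w(M - a) = 0. *)
From HB Require Import structures.
From mathcomp Require Import complex ring lra.
Require Import Defs.
From mathcomp Require Import all_boot all_order all_algebra.
From mathcomp Require Import reals.

Set Implicit Arguments.
Unset Strict Implicit.
Unset Printing Implicit Defensive.

Import Order.TTheory GRing.Theory Num.Theory.
Import passmx.
Local Open Scope ring_scope.

(** * Inner products and the real spectral theorem *)

Section InnerProduct.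
Variables (R : rcfType) (U : lmodType R).

(** The form is a parameter, so that the same facts serve the product weighted by [m] on functions
    and its transport to coordinate vectors. Linearity on the right follows from symmetry. *)
Definition is_inner_product (dot : U -> U -> R) : Prop :=
  [/\ forall v, scalar (dot^~ v), forall u v, dot u v = dot v u
    & forall u, u != 0 -> 0 < dot u u].

Definition selfadjoint (dot : U -> U -> R) (f : U -> U) : Prop :=
  forall u v, dot (f u) v = dot u (f v).

Variable dot : U -> U -> R.
Hypothesis dot_inner : is_inner_product dot.

Lemma dotDl u v x : dot (u + v) x = dot u x + dot v x.
Proof. by have [/(_ x 1 u v)] := dot_inner; rewrite scale1r mul1r. Qed.

Lemma dot0l x : dot 0 x = 0.
Proof. by apply: (addrI (dot 0 x)); rewrite -dotDl !addr0. Qed.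

Lemma dotZl a u x : dot (a *: u) x = a * dot u x.
Proof. by have [/(_ x a u 0)] := dot_inner; rewrite addr0 dot0l addr0. Qed.

Lemma dotC u v : dot u v = dot v u.
Proof. by have [] := dot_inner. Qed.

Lemma dot0r x : dot x 0 = 0.
Proof. by rewrite dotC dot0l. Qed.

Lemma dotZr a u x : dot x (a *: u) = a * dot x u.
Proof. by rewrite dotC dotZl dotC. Qed.

Lemma dot_suml I (r : seq I) (P : pred I) (F : I -> U) x :
  dot (\sum_(i <- r | P i) F i) x = \sum_(i <- r | P i) dot (F i) x.
Proof. by apply: (big_morph (dot^~ x)) => [u v|]; rewrite ?dotDl ?dot0l. Qed.

Lemma dot_sumr I (r : seq I) (P : pred I) (F : I -> U) x :
  dot x (\sum_(i <- r | P i) F i) = \sum_(i <- r | P i) dot x (F i).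
Proof. by rewrite dotC dot_suml; apply: eq_bigr => i _; rewrite dotC. Qed.

Lemma dot_ge0 u : 0 <= dot u u.
Proof.
have [->|u0] := eqVneq u 0; first by rewrite dot0l.
by have [_ _ /(_ u u0)/ltW] := dot_inner.
Qed.

Lemma dot_eq0 u : dot u u = 0 -> u = 0.
Proof.
move=> uu; apply/eqP; apply: contraT => u0.
by have [_ _ /(_ u u0)] := dot_inner; rewrite uu ltxx.
Qed.

End InnerProduct.

Section SpectralTheorem.
Variables (R : rcfType).

(* A non-real root a + ib contributes the factor (X - a)^2 + b^2, and a repeated
   real root a the factor (X - a)^2. *)
Lemma split_of_sqr_ndvd (p : {poly R}) : p \is monic ->
  (forall a b, ~~ (('X - a%:P) ^+ 2 + (b ^+ 2)%:P %| p)) ->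
  exists2 rs, uniq rs & p = \prod_(a <- rs) ('X - a%:P).
Proof.
move=> pm pN; pose toC := real_complex R.
have [zs pE] := closed_field_poly_normal (map_poly toC p).
move: pE; rewrite lead_coef_map (monicP pm) rmorph1 scale1r => pE.
have Im_conjc (z : R[i]) : conjc z = z -> complex.Im z = 0.
  by case: z => x y [] /= e; lra.
(* Since [p] has real coefficients, the conjugate of a non-real root [z] is another root, and the
   product of the two linear factors is the real polynomial (X - Re z)^2 + (Im z)^2, which would
   divide [p]. *)
have Im0 z : z \in zs -> complex.Im z = 0.
  move=> zs_z; apply/eqP; apply: contraT => b0.
  have rz : root (map_poly toC p) z by rewrite pE root_prod_XsubC.
  have rz' : root (map_poly toC p) (conjc z).
    rewrite -complex_root_conj /=.
    suff -> : map_poly conjc (map_poly toC p) = map_poly toC p by [].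
    by apply/polyP => i; rewrite !coef_map /= oppr0.
  have := pN (complex.Re z) (complex.Im z); rewrite -(dvdp_map toC) /=.
  have -> : map_poly toC (('X - (complex.Re z)%:P) ^+ 2 + (complex.Im z ^+ 2)%:P) =
      ('X - z%:P) * ('X - (conjc z)%:P).
    rewrite rmorphD rmorphXn rmorphB /= map_polyX !map_polyC /=.
    have -> : ('X - z%:P) * ('X - (conjc z)%:P) =
      'X ^+ 2 - (z + conjc z)%:P * 'X + (z * conjc z)%:P :> {poly R[i]}.
      by rewrite polyCD polyCM; ring.
    rewrite addcJ -sqr_normc -add_Re2_Im2 /toC !rmorphD !rmorphM ?rmorphXn /=.
    ring.
  rewrite Gauss_dvdp ?dvdp_XsubCl ?rz ?rz' //.
  rewrite coprimep_XsubC root_XsubC.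
  by apply: contra b0 => /eqP/Im_conjc ->.
have {}pE : p = \prod_(a <- [seq complex.Re z | z <- zs]) ('X - a%:P).
  apply: (map_poly_inj toC); rewrite pE rmorph_prod big_map.
  apply: eq_big_seq => z /Im0; rewrite rmorphB /= map_polyX map_polyC /=.
  by case: z => x y /= ->.
move: [seq complex.Re z | z <- zs] pE {Im0} => rs pE; exists rs => //.
(* Taking b = 0 in the hypothesis excludes repeated roots. *)
have: forall a, ~~ (('X - a%:P) ^+ 2 %| \prod_(a <- rs) ('X - a%:P)).
  by move=> a; have := pN a 0; rewrite expr0n addr0 pE.
elim: rs {pE} => // a rs IH rsN /=; rewrite IH ?andbT => [|b].
  apply: contra (rsN a) => ars.
  by rewrite big_cons dvdp_mul2l ?polyXsubC_eq0 // dvdp_XsubCl root_prod_XsubC.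
by apply: contra (rsN b); rewrite big_cons; apply: dvdp_mull.
Qed.

Lemma selfadjoint_diagonalizable n (M : 'M[R]_n) dot : is_inner_product dot ->
  selfadjoint dot (fun u : 'rV_n => u *m M) -> diagonalizable M.
Proof.
case: n M dot => [|n] M dot dotP Msa.
  by rewrite (thinmx0 M); apply: diagonalizable0.
apply/diagonalizableP.
have [||rs rs_uniq ->] := @split_of_sqr_ndvd (mxminpoly M); last by exists rs.
  exact: mxminpoly_monic.
move=> a b; apply/negP => /dvdpP[q qE].
(* With w = e q(M) for a basis vector e, pairing w ((M - a)^2 + b^2) = 0 with w gives |w(M - a)|^2 +
   b^2 |w|^2 = 0. Both terms are nonnegative, so w(M - a) = 0, and the case b = 0 needs no separate
   treatment. *)
have qM0 : horner_mx M (('X - a%:P) * q) = 0.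
  apply/row_matrixP => i; rewrite row0 rowE; set e := delta_mx _ _.
  set w := e *m horner_mx M q.
  have MaE v : v *m horner_mx M ('X - a%:P) = v *m M - a *: v.
    by rewrite rmorphB /= horner_mx_X horner_mx_C mulmxBr mul_mx_scalar.
  rewrite mulrC rmorphM /= mulmxA -/w MaE.
  have w0 : w *m horner_mx M ('X - a%:P) *m horner_mx M ('X - a%:P)
            + b ^+ 2 *: w = 0.
    have := congr1 (mulmx e) (mx_root_minpoly M).
    rewrite mulmx0 qE rmorphM rmorphD /=.
    rewrite expr2 rmorphM /= horner_mx_C -!mulmxE.
    by rewrite mulmxA mulmxDr mul_mx_scalar mulmxA.
  move: w0; rewrite !MaE => /(congr1 (dot^~ w)).
  have BE u v : dot (u *m M - a *: u) v = dot u (v *m M - a *: v).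
    rewrite -!scaleNr !(dotDl dotP) (dotC dotP u) (dotDl dotP).
    by rewrite !(dotZl dotP) !(dotC dotP _ u) Msa.
  rewrite (dotDl dotP) BE (dotZl dotP) (dot0l dotP) => /eqP.
  rewrite paddr_eq0 ?(mulr_ge0 (sqr_ge0 b) (dot_ge0 dotP w)) ?(dot_ge0 dotP) //.
  by move=> /andP[/eqP/(dot_eq0 dotP)].
have p0 : mxminpoly M != 0 by rewrite monic_neq0 ?mxminpoly_monic.
have q0 : q != 0 by apply: contraNneq p0 => q0; rewrite qE q0 mul0r.
have Xq0 : ('X - a%:P) * q != 0 by rewrite mulf_neq0 ?polyXsubC_eq0.
have := dvdp_leq Xq0 (mxminpoly_min qM0); apply/negP.
(* The annihilating polynomial (X - a) q has degree one less than the minimal polynomial, a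
   contradiction. *)
have s2 : size (('X - a%:P) ^+ 2 + (b ^+ 2)%:P) = 3%N.
  by rewrite size_polyDl size_exp_XsubC // (leq_ltn_trans (size_polyC_leq1 _)).
have sz0 : size (('X - a%:P) ^+ 2 + (b ^+ 2)%:P) != 0%N by rewrite s2.
rewrite qE !size_mul ?polyXsubC_eq0 // -?size_poly_eq0 // s2 size_XsubC.
by rewrite addn3 add2n -ltnNge.
Qed.

End SpectralTheorem.

(** * Dimensions of eigenspaces of diagonalizable matrices *)

Lemma mxrank_diag (F : fieldType) n (d : 'rV[F]_n) :
  \rank (diag_mx d) = #|[pred i | d 0 i != 0]|.
Proof.
have -> : \rank (diag_mx d) =
    \rank (\sum_(i | d 0 i != 0) <<delta_mx 0 i : 'rV[F]_n>>)%MS.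
  apply/eqP; rewrite eqn_leq; apply/andP; split; apply: mxrankS.
    apply/row_subP => i; rewrite row_diag_mx.
    have [->|di] := eqVneq (d 0 i) 0; first by rewrite scale0r sub0mx.
    by rewrite scalemx_sub // (sumsmx_sup i) // genmxE.
  apply/sumsmx_subP => i di; rewrite genmxE.
  have -> : delta_mx 0 i = (d 0 i)^-1 *: row i (diag_mx d).
    by rewrite row_diag_mx scalerA mulVf // scale1r.
  by rewrite scalemx_sub // row_sub.
have /mxdirectP -> /= : mxdirect (\sum_(i | d 0 i != 0) <<delta_mx 0 i : 'rV[F]_n>>).
  by apply: (@mxdirect_delta _ _ _ _ id) => i j _ _.
rewrite (eq_bigr (fun=> 1%N)) ?sum1_card // => i _.
by rewrite mxrank_gen mxrank_delta.
Qed.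

(** Conjugation by [P] turns M - a into the diagonal matrix with entries d_i - a, whose corank is
    the number of zero entries. *)
Lemma mxrank_eigenspace_diag (F : fieldType) n (M P : 'M[F]_n) d a :
  P \in unitmx -> P *m M = diag_mx d *m P ->
  \rank (eigenspace M a) = #|[pred i | d 0 i == a]|.
Proof.
move=> Pu PM; rewrite mxrank_ker.
have rP : row_full P by rewrite row_full_unit.
rewrite -(eqmxMfull (M - a%:M) rP) mulmxBr PM mul_mx_scalar -mul_scalar_mx.
rewrite -mulmxBl mxrankMfree ?row_free_unit // -diag_const_mx -linearB mxrank_diag.
rewrite -[X in (X - _)%N](card_ord n) -(cardC [pred i | d 0 i == a]).
rewrite (@eq_card _ [pred i | (d - const_mx a) 0 i != 0] [predC [pred i | d 0 i == a]]).
  by rewrite addnK.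
by move=> i; rewrite !inE !mxE subr_eq0.
Qed.

(** A row basis of [M] yields a spanning family, hence the upper bound. Applied to [kermx M] as
    well, this bound becomes an equality by rank-nullity. *)
Lemma dim_vsof (F : fieldType) (U : vectType F) (e : (\dim {:U}).-tuple U)
    (M : 'M[F]_(\dim {:U})) :
  basis_of {:U} e -> \dim (vsof e M) = \rank M.
Proof.
move=> be.
have dim_le (A : 'M[F]_(\dim {:U})) : (\dim (vsof e A) <= \rank A)%N.
  pose X := [tuple vecof e (row i (row_base A)) | i < \rank A].
  rewrite -[leqRHS](size_tuple X); apply: leq_trans (dim_span X).
  apply/dimvS/subvP => x; rewrite -(rVof_sub be) -(eq_row_base A).
  move=> /submxP[c xE]; rewrite -(rVofK be x) xE mulmx_sum_row linear_sum.
  apply: memv_suml => i _; rewrite linearZ memvZ // memv_span //.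
  by apply/mapP; exists i; rewrite ?mem_enum.
apply/eqP; rewrite eqn_leq dim_le /= -(leq_add2l (\rank (kermx M))).
have -> : (\rank (kermx M) + \rank M = \dim {:U})%N.
  by rewrite mxrank_ker subnK ?rank_leq_row.
rewrite -[leqLHS](limg_ker_dim (hommx e e M) fullv) capfv leq_add2r.
by rewrite (lker_ker be) (hommxK be be) dim_le.
Qed.

(** * Eigenvalue lists of self-adjoint operators *)

Section Eigenvalues.
Variables (R : realType) (U : vectType R) (dot : U -> U -> R) (T : 'End(U)).
Hypotheses (dotP : is_inner_product dot) (Tsa : selfadjoint dot T).

Let b := vbasis {:U}.
Let bP : basis_of {:U} b := vbasisP {:U}.
Let M := mxof b b T.

(** The rows of [P] are the coordinates of an eigenbasis. Each value occurs on the diagonal as often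
    as the dimension of its eigenspace, which is also its multiplicity in [eigenvalues T]. *)
Lemma eigenbasis : exists P d, [/\ P \in unitmx, P *m M = diag_mx d *m P
  & perm_eq (eigenvalues T) [seq d 0 i | i : 'I_(\dim {:U})]].
Proof.
pose dotv (u v : 'rV[R]_(\dim {:U})) := dot (vecof b u) (vecof b v).
have dotvP : is_inner_product dotv.
  have [dlin dsym dpos] := dotP; split=> [v a x y|u v|u u0].
  - by rewrite /dotv linearP dlin.
  - exact: dsym.
  - by apply: dpos; rewrite vecof_eq0.
have Msa : selfadjoint dotv (fun u => u *m M).
  by move=> u v; rewrite /dotv -!(hom_vecof _ bP) Tsa.
have [P Pu /diagonalizable_forPex[d /(simmxP Pu) PM]] :=
  selfadjoint_diagonalizable dotvP Msa.
exists P, d; split=> //; apply/allP => a _ /=.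
have [_ ->] := eigenvaluesP T.
rewrite (leigenspaceE bP) dim_vsof // (mxrank_eigenspace_diag _ Pu PM).
by rewrite -sum1_card -sum1_count big_image_cond.
Qed.

Lemma size_eigenvalues : size (eigenvalues T) = \dim {:U}.
Proof.
have [P [d [_ _ /perm_size->]]] := eigenbasis.
by rewrite size_map -cardE card_ord.
Qed.

Lemma sum_eigenvalues : \sum_(a <- eigenvalues T) a = \tr M.
Proof.
have [P [d [Pu PM /(perm_big _)->]]] := eigenbasis.
rewrite big_image /= -mxtrace_diag.
have -> : M = invmx P *m (diag_mx d *m P) by rewrite -PM mulKmx.
by rewrite mxtrace_mulC mulmxK.
Qed.

Lemma sum_leigenspace :
  (\sum_(a <- undup (eigenvalues T)) leigenspace T a)%VS = fullv.
Proof.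
have [P [d [Pu PM dE]]] := eigenbasis.
apply/eqP; rewrite eqEsubv subvf /=; apply/subvP => x _.
rewrite -(rVofK bP x) -[rVof b x](mulmxKV Pu) mulmx_sum_row.
rewrite linear_sum memv_suml // => i _; rewrite linearZ memvZ //.
have di : d 0 i \in undup (eigenvalues T).
  by rewrite mem_undup (perm_mem dE) map_f ?mem_enum.
rewrite (bigD1_seq _ di (undup_uniq _)) /=.
apply: (subvP (addvSl _ _)); rewrite (leigenspaceE bP).
rewrite -rVof_sub // vecofK //; apply/eigenspaceP.
by rewrite -row_mul PM row_mul row_diag_mx -scalemxAl -rowE.
Qed.

Lemma leigenspaceP a x : reflect (T x = a *: x) (x \in leigenspace T a).
Proof.
rewrite memv_ker add_lfunE opp_lfunE scale_lfunE id_lfunE subr_eq0.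
exact: eqP.
Qed.

(** [undup] takes each eigenspace once, so that distinct summands are orthogonal. *)
Definition spectral_subspace (P : pred R) : {vspace U} :=
  (\sum_(a <- undup (eigenvalues T) | P a) leigenspace T a)%VS.

(** Subadditivity of dimension gives the opposite inequality for every predicate. Using it for the
    complement of [P], and the fact that the two spectral subspaces span everything, yields the
    lower bound. *)
Lemma dim_spectral_subspace P :
  (count P (eigenvalues T) <= \dim (spectral_subspace P))%N.
Proof.
have le Q : (\dim (spectral_subspace Q) <= count Q (eigenvalues T))%N.
  apply: leq_trans (dimv_leq_sum _ _ _) _.
  have -> : count Q (eigenvalues T) =
      (\sum_(a <- undup (eigenvalues T) | Q a) count_mem a (eigenvalues T))%N.
    rewrite -sum1_count -big_undup_iterop_count.
    by apply: eq_bigr => a _; rewrite Monoid.iteropE iter_addn mul1n addn0.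
  by apply: leq_sum => a _; rewrite (eigenvaluesP T).2.
rewrite -(leq_add2r (count (predC P) (eigenvalues T))) count_predC.
rewrite size_eigenvalues -sum_leigenspace (bigID P) /=.
by apply: leq_trans (dimv_add_leqif _ _) _; rewrite leq_add2l le.
Qed.

End Eigenvalues.

(** * Counting in sorted lists *)

Section SortedSeq.
Variables (R : realDomainType) (s : seq R).
Hypothesis s_sorted : sorted <=%R s.

Lemma le_nth_sorted i j : (i <= j)%N -> (j < size s)%N -> s`_i <= s`_j.
Proof.
move=> ij js.
have ltis := leq_ltn_trans ij js.
exact: (sorted_leq_nth le_trans le_refl 0 s_sorted) ltis js ij.
Qed.

Lemma count_ge_nth i : (size s - i <= count (>= s`_i)%R s)%N.
Proof.
rewrite -[X in (_ <= count _ X)%N](cat_take_drop i s) count_cat -size_drop.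
suff /eqP <- : count (>= s`_i)%R (drop i s) == size (drop i s) by apply: leq_addl.
rewrite -all_count; apply/(all_nthP 0) => j.
rewrite size_drop nth_drop ltn_subRL => js /=.
by apply: le_nth_sorted; rewrite ?leq_addr.
Qed.

Lemma count_le_nth i : (i < size s)%N -> (i < count (<= s`_i)%R s)%N.
Proof.
move=> si; rewrite -[X in (_ <= count _ X)%N](cat_take_drop i.+1 s) count_cat.
have sz : size (take i.+1 s) = i.+1 by rewrite size_takel.
suff /eqP-> : count (<= s`_i)%R (take i.+1 s) == size (take i.+1 s).
  by rewrite sz leq_addr.
rewrite -all_count; apply/(all_nthP 0) => j; rewrite sz => ji.
by rewrite nth_take //=; apply: le_nth_sorted.
Qed.

Lemma mem_sorted_bounds a : a \in s -> head 0 s <= a <= last 0 s.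
Proof.
move=> /(nthP 0)[i si <-]; rewrite -nth0 -nth_last !le_nth_sorted //.
  by case: (size s) si.
by case: (size s) si.
Qed.

End SortedSeq.

(** * Rayleigh quotients and scalar operators *)

Section Rayleigh.
Variables (R : realType) (U : vectType R) (dot : U -> U -> R) (T : 'End(U)).
Hypotheses (dotP : is_inner_product dot) (Tsa : selfadjoint dot T).

Lemma eigenvectors_orthogonal a b u v :
  u \in leigenspace T a -> v \in leigenspace T b -> a != b -> dot u v = 0.
Proof.
move=> /leigenspaceP Tu /leigenspaceP Tv; rewrite -subr_eq0 => ab.
have := Tsa u v; rewrite Tu Tv (dotZl dotP) (dotZr dotP) => /eqP.
by rewrite -subr_eq0 -mulrBl mulf_eq0 (negPf ab) => /eqP.
Qed.

(** The weights [q i] are the squared norms of the eigencomponents of [x]; the cross terms vanish by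
    orthogonality. The Rayleigh quotient is thus a weighted mean of the selected eigenvalues. *)
Lemma spectral_decomposition P x : x \in spectral_subspace T P ->
  exists (n : nat) (a q : 'I_n -> R),
    [/\ forall i, a i \in eigenvalues T, forall i, 0 <= q i,
        dot x x = \sum_(i | P (a i)) q i
      & dot (T x) x = \sum_(i | P (a i)) a i * q i].
Proof.
rewrite /spectral_subspace (big_nth 0) big_mkord; set r := undup _.
move=> /memv_sumP[u uE ->]; pose a (i : 'I_(size r)) := r`_i.
exists (size r), a, (fun i => dot (u i) (u i)); split=> [i|i||].
- by rewrite -mem_undup mem_nth.
- exact: dot_ge0.
- rewrite (dot_suml dotP); apply: eq_bigr => i Pi; rewrite (dot_sumr dotP).
  rewrite (bigD1 i) //= big1 ?addr0 // => j /andP[Pj ji].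
  apply: (eigenvectors_orthogonal (uE _ Pi) (uE _ Pj)).
  by rewrite nth_uniq ?undup_uniq // eq_sym.
rewrite linear_sum (dot_suml dotP) /=; apply: eq_bigr => i Pi.
rewrite (leigenspaceP _ _ _ (uE _ Pi)) (dotZl dotP) (dot_sumr dotP); congr (_ * _).
rewrite (bigD1 i) //= big1 ?addr0 // => j /andP[Pj ji].
apply: (eigenvectors_orthogonal (uE _ Pi) (uE _ Pj)).
by rewrite nth_uniq ?undup_uniq // eq_sym.
Qed.

Lemma rayleigh_ge (P : pred R) c x : {in eigenvalues T, forall a, P a -> c <= a} ->
  x \in spectral_subspace T P -> c * dot x x <= dot (T x) x.
Proof.
move=> Pc /spectral_decomposition[n [a [q [aT q0 -> ->]]]].
by rewrite mulr_sumr; apply: ler_sum => i Pi; rewrite ler_wpM2r ?Pc.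
Qed.

Lemma rayleigh_le (P : pred R) c x : {in eigenvalues T, forall a, P a -> a <= c} ->
  x \in spectral_subspace T P -> dot (T x) x <= c * dot x x.
Proof.
move=> Pc /spectral_decomposition[n [a [q [aT q0 -> ->]]]].
by rewrite mulr_sumr; apply: ler_sum => i Pi; rewrite ler_wpM2r ?Pc.
Qed.

Lemma eigenvalues_bounds a :
  a \in eigenvalues T -> lambda_min T <= a <= lambda_max T.
Proof. exact: mem_sorted_bounds (eigenvaluesP T).1 _. Qed.

Lemma rayleigh_bounds x :
  lambda_min T * dot x x <= dot (T x) x <= lambda_max T * dot x x.
Proof.
have xT : x \in spectral_subspace T predT.
  by rewrite /spectral_subspace (sum_leigenspace dotP Tsa) memvf.
rewrite (rayleigh_ge _ xT) ?(rayleigh_le _ xT) // => a /eigenvalues_bounds.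
  by case/andP.
by case/andP.
Qed.

Lemma scalar_operator_of_eigenvalues c :
  {in eigenvalues T, forall a, a = c} -> scalar_operator T.
Proof.
move=> Tc; exists c; apply/lfunP => x; rewrite scale_lfunE id_lfunE.
apply/leigenspaceP; have := memvf x; rewrite -(sum_leigenspace dotP Tsa).
apply/subvP; rewrite big_seq.
apply: (big_ind (fun V => V <= leigenspace T c)%VS) => [|V W Vc Wc|a].
- exact: sub0v.
- by rewrite subv_add Vc.
by rewrite mem_undup => /Tc ->.
Qed.

End Rayleigh.

Lemma scalar_eigenvalues (R : realType) (U : vectType R) (c : R) :
  {in eigenvalues (c *: \1%VF : 'End(U)), forall a, a = c}.
Proof.
move=> a; rewrite -has_pred1 has_count (eigenvaluesP _).2 lt0n dimv_eq0.
rewrite /leigenspace -scalerBl; apply: contraNeq; rewrite eq_sym -subr_eq0 => ca.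
rewrite -subv0; apply/subvP => x; rewrite memv_ker scale_lfunE id_lfunE.
by rewrite scaler_eq0 (negPf ca) memv0.
Qed.

Lemma memv_cap_neq0 (F : fieldType) (U : vectType F) (V W : {vspace U}) :
  (\dim {:U} < \dim V + \dim W)%N -> exists x, [/\ x != 0, x \in V & x \in W].
Proof.
rewrite -dimv_sum_cap => h; exists (vpick (V :&: W)).
have VW : (V :&: W)%VS != 0%VS.
  apply: contraTneq h => ->; rewrite dimv0 addn0 -leqNgt.
  exact: dimvS (subvf _).
by have := memv_pick (V :&: W); rewrite memv_cap vpick0 => /andP[].
Qed.

(** * Weyl's inequalities *)

Section Weyl.
Variables (R : realType) (U : vectType R) (dot : U -> U -> R).
Variables (N T : 'End(U)).
Hypotheses (dotP : is_inner_product dot).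
Hypotheses (Nsa : selfadjoint dot N) (Tsa : selfadjoint dot T).

Lemma selfadjoint_add : selfadjoint dot (N + T)%R.
Proof.
move=> u v; rewrite !add_lfunE (dotDl dotP) Nsa Tsa.
by rewrite !(dotC dotP u) (dotDl dotP).
Qed.
Let Asa := selfadjoint_add.

Lemma weyl_le i : (i < \dim {:U})%N ->
  (eigenvalues (N + T))`_i <= (eigenvalues N)`_i + lambda_max T.
Proof.
move=> iU; set l := _`_i; set k := _`_i.
have [x [x0 xA xN]] : exists x, [/\ x != 0, x \in spectral_subspace (N + T) (>= l)
    & x \in spectral_subspace N (<= k)].
  (* With n the dimension of [U] and [i] counted from 0, the two subspaces have dimensions at least
     n - i and i + 1, whose sum exceeds n. *)
  apply: memv_cap_neq0.
  apply: leq_trans (leq_add (dim_spectral_subspace dotP Asa _)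
                            (dim_spectral_subspace dotP Nsa _)).
  have /= := count_ge_nth (eigenvaluesP (N + T)).1 i.
  have /= := count_le_nth (eigenvaluesP N).1 (i := i).
  rewrite !(size_eigenvalues dotP) // -/k -/l => /(_ iU) cN.
  by rewrite leq_subLR => /leq_ltn_trans; apply; rewrite addnC ltn_add2l.
have xx0 : 0 < dot x x by have [_ _ /(_ x x0)] := dotP.
rewrite -(ler_pM2r xx0) mulrDl.
have /andP[_ Tx] := rayleigh_bounds dotP Tsa x.
have Nx : dot (N x) x <= k * dot x x by apply: (rayleigh_le dotP Nsa _ xN).
have Ax : l * dot x x <= dot ((N + T)%R x) x by apply: (rayleigh_ge dotP Asa _ xA).
by apply: le_trans Ax _; rewrite add_lfunE (dotDl dotP) lerD.
Qed.

Lemma weyl_ge i : (i < \dim {:U})%N ->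
  (eigenvalues N)`_i + lambda_min T <= (eigenvalues (N + T))`_i.
Proof.
(* Both spectral cuts are reversed; the dimensions are now at least i + 1 and n - i. *)
move=> iU; set k := _`_i; set l := _`_i.
have [x [x0 xA xN]] : exists x, [/\ x != 0, x \in spectral_subspace (N + T) (<= l)
    & x \in spectral_subspace N (>= k)].
  apply: memv_cap_neq0.
  apply: leq_trans (leq_add (dim_spectral_subspace dotP Asa _)
                            (dim_spectral_subspace dotP Nsa _)).
  have /= := count_le_nth (eigenvaluesP (N + T)).1 (i := i).
  have /= := count_ge_nth (eigenvaluesP N).1 i.
  rewrite !(size_eigenvalues dotP) // -/k -/l leq_subLR => cN /(_ iU) cA.
  by apply: leq_ltn_trans cN _; rewrite ltn_add2r.
have xx0 : 0 < dot x x by have [_ _ /(_ x x0)] := dotP.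
rewrite -(ler_pM2r xx0) mulrDl.
have /andP[Tx _] := rayleigh_bounds dotP Tsa x.
have Nx : k * dot x x <= dot (N x) x by apply: (rayleigh_ge dotP Nsa _ xN).
have Ax : dot ((N + T)%R x) x <= l * dot x x by apply: (rayleigh_le dotP Asa _ xA).
by apply: le_trans Ax; rewrite add_lfunE (dotDl dotP) lerD.
Qed.

(* Compare the traces of N + T, N and T. *)
Lemma sum_eigenvalues_shift c :
  (forall i, (i < \dim {:U})%N ->
    (eigenvalues (N + T))`_i = (eigenvalues N)`_i + c) ->
  \sum_(a <- eigenvalues T) (a - c) = 0.
Proof.
move=> Ac; rewrite sumrB big_const_seq count_predT.
rewrite (size_eigenvalues dotP Tsa) iter_addr addr0.
have : \sum_(a <- eigenvalues (N + T)) a =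
    \sum_(a <- eigenvalues N) a + \sum_(a <- eigenvalues T) a.
  rewrite (sum_eigenvalues dotP Asa) (sum_eigenvalues dotP Nsa).
  by rewrite (sum_eigenvalues dotP Tsa) -mxtraceD -linearD.
rewrite (big_nth 0) [X in _ = X + _](big_nth 0) !big_mkord.
rewrite (size_eigenvalues dotP Asa) (size_eigenvalues dotP Nsa).
under eq_bigr => i _ do rewrite Ac //.
rewrite big_split /= sumr_const card_ord => /addrI <-.
by rewrite subrr.
Qed.

(** The differences a - c have a constant sign and sum to zero, so each one vanishes. The two
    alternatives serve the lower and the upper extreme eigenvalue. *)
Lemma shift_scalar_operator c :
  {in eigenvalues T, forall a, c <= a} \/ {in eigenvalues T, forall a, a <= c} ->
  (forall i, (i < \dim {:U})%N ->
    (eigenvalues (N + T))`_i = (eigenvalues N)`_i + c) ->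
  scalar_operator T.
Proof.
move=> cT /sum_eigenvalues_shift/eqP sum0.
apply: (scalar_operator_of_eigenvalues dotP Tsa (c := c)) => a aT.
have {cT} [cT|cT] := cT.
  move: sum0; rewrite big_seq_cond psumr_eq0 => [|b]; last first.
    by rewrite andbT subr_ge0; apply: cT.
  by move=> /allP/(_ a aT); rewrite aT /= subr_eq0 => /eqP.
move: sum0; rewrite -oppr_eq0 -sumrN big_seq_cond psumr_eq0 => [|b]; last first.
  by rewrite andbT opprB subr_ge0; apply: cT.
by move=> /allP/(_ a aT); rewrite aT /= oppr_eq0 subr_eq0 => /eqP.
Qed.

End Weyl.

(** * Dirichlet and Neumann Laplacians *)

Section Graph.
Variables (R : realType) (V : finType) (G : wgraph R V).
Local Notation m := (measure G).
Local Notation w := (weight G).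

Definition dot_on (S : {set V}) (u v : FunOn R S) : R :=
  \sum_(x : vtx S) m (val x) * u x * v x.

Lemma dot_on_inner_product S : is_inner_product (dot_on (S := S)).
Proof.
split=> [v a u u'|u v|u u0].
- rewrite /dot_on mulr_sumr -big_split /=; apply: eq_bigr => x _.
  by rewrite !ffunE -[a *: _]/(a * u x); ring.
- by apply: eq_bigr => x _; ring.
have t_ge0 (x : vtx S) : 0 <= m (val x) * u x * u x.
  by rewrite -mulrA mulr_ge0 ?(ltW (measure_gt0 G _)) //; apply: (sqr_ge0 (u x : R)).
rewrite lt_def sumr_ge0 // andbT; apply: contra u0.
rewrite psumr_eq0 // => /allP u0; apply/eqP/ffunP => x; rewrite ffunE.
have := u0 x (mem_index_enum _).
by rewrite /= !mulf_eq0 gt_eqF ?measure_gt0 //= orbb => /eqP.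
Qed.

(** The measure in the inner product cancels the factor 1/m, leaving a double sum that is symmetric
    because [w] is. *)
Lemma adjacency_adjoint (S T : {set V}) (u : FunOn R S) (v : FunOn R T) :
  dot_on (adjacency G T u) v = dot_on u (adjacency G S v).
Proof.
transitivity (\sum_(x : vtx T) \sum_(y : vtx S) v x * u y * w (val x) (val y)).
  apply: eq_bigr => x _; rewrite ffunE mulrA divff ?gt_eqF ?measure_gt0 // mul1r.
  by rewrite mulr_suml; apply: eq_bigr => y _; ring.
rewrite exchange_big; apply: eq_bigr => y _; rewrite ffunE mulrAC mulrA.
rewrite divff ?gt_eqF ?measure_gt0 // mul1r mulr_suml.
by apply: eq_bigr => x _; rewrite (weight_sym G (val x)); ring.
Qed.

Lemma sum_extend0 (S : {set V}) (u : FunOn R S) (f : V -> R) :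
  \sum_y extend0 u y * f y = \sum_(y : vtx S) u y * f (val y).
Proof.
rewrite (bigID [in S]) /= [X in _ + X]big1 => [|y yS]; last first.
  by rewrite extend0_out ?mul0r.
rewrite addr0 big_sub; apply: eq_bigr => y _.
by rewrite extend0_in.
Qed.

Lemma laplacian_extend0 (S : {set V}) (u : FunOn R S) x :
  laplacian G (extend0 u) x =
  (m x)^-1 * (extend0 u x * \sum_y w x y - \sum_(y : vtx S) u y * w x (val y)).
Proof.
rewrite ffunE -sum_extend0; congr (_ * _); rewrite mulr_sumr -sumrB.
by apply: eq_bigr => y _; rewrite mulrBl.
Qed.

Lemma laplacian_extend0_disjoint (S T : {set V}) (u : FunOn R S) (x : vtx T) :
  [disjoint S & T] -> laplacian G (extend0 u) (val x) = - adjacency G T u x.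
Proof.
move=> /disjointFl ST; rewrite laplacian_extend0 extend0_out ?ST ?(valP x) //.
by rewrite mul0r sub0r mulrN ffunE.
Qed.

(** The operator is a diagonal degree term minus the adjacency operator of [S] to itself, and both
    are symmetric. This covers the Dirichlet Laplacian as well as [L_B]. *)
Lemma dirichlet_on_selfadjoint S :
  selfadjoint (dot_on (S := S)) (dirichlet_on G S).
Proof.
have DE (u v : FunOn R S) : dot_on (dirichlet_on G S u) v =
    \sum_(x : vtx S) (\sum_y w (val x) y) * u x * v x
    - dot_on (adjacency G S u) v.
  rewrite -sumrB; apply: eq_bigr => x _.
  rewrite lfunE /= [X in _ * X * _ = _]ffunE laplacian_extend0 extend0_in ffunE.
  by field; rewrite gt_eqF ?measure_gt0.
have dC := dotC (dot_on_inner_product S).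
move=> u v; rewrite [RHS]dC !DE [X in _ - X]adjacency_adjoint [X in _ - X]dC.
by congr (_ - _); apply: eq_bigr => x _; ring.
Qed.

Variable B : {set V}.
Hypothesis intB : interior_in_components G B.

Lemma dirichlet_eq_neumann_add :
  dirichlet_laplacian G B = neumann_laplacian G B + A_LB_A G B.
Proof.
have linN := neumann_extension_linear intB.
(* [linfun] can be evaluated once the Neumann extension carries its linear structure. *)
pose E : {linear FunOn R (~: B) -> Fun R V} :=
  HB.pack (neumann_extension G (B := B)) (GRing.isLinear.Build R _ _ _ _ linN).
apply/lfunP => u; rewrite add_lfunE.
have -> : neumann_laplacian G B u =
    restrict (~: B) (laplacian G (neumann_extension G u)).
  exact: (lfunE (restrict (~: B) \o laplacian G \o E) u).
pose f := (L_B G B)^-1%VF (A_Omega G B u).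
have Lf : L_B G B f = A_Omega G B u by rewrite /f lker0_lfunVK // lker_L_B.
have -> : A_LB_A G B u = adjacency G (~: B) f.
  by rewrite !comp_lfunE [LHS]lfunE.
have disjB : [disjoint B & ~: B] by rewrite disjoints_subset setCK.
(* On [B] the Laplacian of [extend0 u] is minus A_Omega u, and that of [extend0 f] is L_B f =
   A_Omega u, so the sum is harmonic there. *)
rewrite (neumann_extension_unique intB (v := extend0 u + extend0 f)); last first.
  split=> [x|x xB].
    by rewrite ffunE extend0_in extend0_out ?addr0 //; have := valP x; rewrite inE.
  rewrite linearD -[x]/(val (exist _ x xB : vtx B)) ffunE.
  rewrite laplacian_extend0_disjoint; last by rewrite disjoint_sym.
  move: Lf => /ffunP/(_ (exist _ x xB)).
  rewrite [L_B G B f]lfunE [A_Omega G B u]lfunE /= [X in X = _]ffunE => -> /=.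
  by rewrite addNr.
have -> : dirichlet_laplacian G B u = restrict (~: B) (laplacian G (extend0 u)).
  exact: lfunE.
(* On the interior the Laplacian of [extend0 f] is minus A_B f, which cancels the term T u. *)
apply/ffunP => x; rewrite !linearD [RHS]ffunE [X in _ = X + _]ffunE.
rewrite [X in _ = _ + X + _]ffunE.
by rewrite laplacian_extend0_disjoint // subrK.
Qed.

(** [A_B] and [A_Omega] are adjoint to each other, and the inverse of the self-adjoint [L_B] is
    self-adjoint. *)
Lemma A_LB_A_selfadjoint : selfadjoint (dot_on (S := ~: B)) (A_LB_A G B).
Proof.
have Lsa := dirichlet_on_selfadjoint (S := B).
have LK : cancel (L_B G B)^-1%VF (L_B G B).
  by move=> u; rewrite lker0_lfunVK // lker_L_B.
have LVsa : selfadjoint (dot_on (S := B)) (L_B G B)^-1%VF.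
  by move=> u v; rewrite -{1}[v]LK -[u in RHS]LK Lsa.
move=> u v; rewrite !comp_lfunE ![A_B _ _ _]lfunE ![A_Omega _ _ _]lfunE /=.
by rewrite adjacency_adjoint LVsa adjacency_adjoint.
Qed.

(** Obtained from the decomposition, as a difference of two self-adjoint operators. *)
Lemma neumann_selfadjoint :
  selfadjoint (dot_on (S := ~: B)) (neumann_laplacian G B).
Proof.
have dotP := dot_on_inner_product (~: B).
have -> : neumann_laplacian G B = dirichlet_laplacian G B - A_LB_A G B.
  by rewrite dirichlet_eq_neumann_add addrK.
move=> u v; rewrite !add_lfunE !opp_lfunE -!scaleN1r (dotDl dotP) (dotZl dotP).
rewrite dirichlet_on_selfadjoint A_LB_A_selfadjoint.
by rewrite -(dotZr dotP) !(dotC dotP u) -(dotDl dotP).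
Qed.

End Graph.

(** * Comparison of Dirichlet and Neumann eigenvalues *)

Lemma dim_FunOn (R : realType) (V : finType) (S : {set V}) :
  \dim {: FunOn R S} = #|S|.
Proof. by rewrite dimvf /dim /= card_sig muln1. Qed.

Theorem theorem1p6 (R : realType) (V : finType) (G : wgraph R V) (B : {set V})
    (B_neq0 : B != set0) (G_int : interior_in_components G B) :
  let T := A_LB_A G B in
  let lambda := fun i : nat => nth 0 (eigenvalues (dirichlet_laplacian G B)) i in
  let nu := fun i : nat => nth 0 (eigenvalues (neumann_laplacian G B)) i in
  [/\ forall i : 'I_#|~: B|,
        nu i + lambda_min T <= lambda i /\ lambda i <= nu i + lambda_max T,
      (forall i : 'I_#|~: B|, lambda i = nu i + lambda_min T)
        <-> scalar_operator T
    & (forall i : 'I_#|~: B|, lambda i = nu i + lambda_max T)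
        <-> scalar_operator T].
Proof.
move=> T lambda nu.
have dotP := dot_on_inner_product G (~: B).
have Tsa : selfadjoint (dot_on G (S := ~: B)) T := A_LB_A_selfadjoint G_int.
have Nsa := neumann_selfadjoint G_int.
have DE : dirichlet_laplacian G B = neumann_laplacian G B + T.
  exact: dirichlet_eq_neumann_add.
have dimE := dim_FunOn R (~: B).
have bounds (i : 'I_#|~: B|) :
    nu i + lambda_min T <= lambda i /\ lambda i <= nu i + lambda_max T.
  have iU : (i < \dim {: FunOn R (~: B)})%N by rewrite dimE.
  by rewrite /lambda DE; split; [apply: (weyl_ge dotP) | apply: (weyl_le dotP)].
have scalar_of c :
    {in eigenvalues T, forall a, c <= a} \/ {in eigenvalues T, forall a, a <= c} ->
    (forall i : 'I_#|~: B|, lambda i = nu i + c) -> scalar_operator T.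
  move=> cT lc; apply: (shift_scalar_operator dotP Nsa Tsa cT) => i; rewrite -DE dimE.
  by move=> iU; apply: (lc (Ordinal iU)).
(* The index [i] witnesses that the interior is nonempty, so [head] and [last] return actual
   eigenvalues and not the default 0. *)
have extremes (i : 'I_#|~: B|) : scalar_operator T -> lambda_min T = lambda_max T.
  move=> [c Tc]; have c_eq : {in eigenvalues T, forall a, a = c}.
    by rewrite Tc; apply: scalar_eigenvalues.
  have: (0 < size (eigenvalues T))%N.
    by rewrite (size_eigenvalues dotP Tsa) dimE (leq_ltn_trans _ (ltn_ord i)).
  rewrite /lambda_min /lambda_max; case: (eigenvalues T) c_eq => //= a s c_eq _.
  by rewrite (c_eq _ (mem_last a s)); apply: c_eq (mem_head a s).
split=> //; split=> [|Tc i].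
- by apply: scalar_of; left=> a /eigenvalues_bounds/andP[].
(* When the extreme eigenvalues of [T] coincide, the two bounds pinch [lambda i]. *)
- have [lo hi] := bounds i; apply/le_anti; rewrite lo andbT.
  by rewrite (extremes i Tc).
- by apply: scalar_of; right=> a /eigenvalues_bounds/andP[].
have [lo hi] := bounds i; apply/le_anti; rewrite hi.
by rewrite -(extremes i Tc).
Qed.
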